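(* Let ${\boldsymbol a}=(a_i)_{i\ge0}$ be a sequence of non-negative integers with $a_0>0$ such that for some $k\ge0$ and some integer $a>0$ one has $a_i=a$ for all $i\ge k$, and let $\varrho_{\boldsymbol a}$ be the substitution on $\mathcal{A}=\mathbb{N}_0\cup\{\infty\}$ given by $\varrho_{\boldsymbol a}([0])=[0]^{a_0}[1]$, $\varrho_{\boldsymbol a}([i])=[0]^{a_i}[i-1][i+1]$ for integers $i>0$, and $\varrho_{\boldsymbol a}([\infty])=[0]^a[\infty][\infty]$. Suppose $\varrho_{\boldsymbol a}$ is a non-constant length substitution. Then no Delone set $\Lambda\subset\mathbb{R}$ arising from $\varrho_{\boldsymbol a}$ is bounded distance equivalent to $\alpha\mathbb{Z}$, for any $\alpha>0$.
   Context: $\mathbb{N}_0=\{0,1,2,\dots\}$, $\mathcal{A}$ is the one-point compactification of $\mathbb{N}_0$ (finite words carry the disjoint-union topology of the products $\mathcal{A}^n$), and $[0]^m$ is the word of $m$ letters $[0]$. The substitution extends to words by concatenation. It has constant length if all words $\varrho_{\boldsymbol a}(b)$, $b\in\mathcal{A}$, have the same number of letters. Natural tile lengths: let $\mu\in(0,1)$ be the unique real number with $\frac1\mu=\sum_{i\ge0}a_i\mu^i$ and $\lambda=\mu+\frac1\mu$. Set $\ell([0])=1$, $\ell([m])=\mu^m+\sum_{j=1}^m\sum_{i=j}^\infty a_i\mu^{i+m+1-2j}$ for integers $m>0$, and $\ell([\infty])=\lim_{m\to\infty}\ell([m])$. Then $\ell$ is a strictly positive continuous function on $\mathcal{A}$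 with $\sum_{c\in\varrho_{\boldsymbol a}(b)}\ell(c)=\lambda\,\ell(b)$ (sum with multiplicity) for all $b\in\mathcal{A}$. Delone sets arising from $\varrho_{\boldsymbol a}$: let $X_\varrho\subset\mathcal{A}^{\mathbb{Z}}$ be the shift space of $\varrho_{\boldsymbol a}$, i.e. the bi-infinite sequences all of whose finite subwords lie in the closure of the set of subwords of the words $\varrho_{\boldsymbol a}^n(b)$, $n\ge1$, $b\in\mathcal{A}$. Each $x\in X_\varrho$ determines (up to translation) a tiling of $\mathbb{R}$ by consecutive intervals of lengths $\ell(x_j)$, $j\in\mathbb{Z}$; the associated Delone set consists of the left endpoints of the tiles. (An example is the set of left endpoints of the bi-infinite fixed point tiling with seed $\infty|0$.) Two Delone sets $\Lambda,\Lambda'\subset\mathbb{R}$ are bounded distance equivalent if there are a bijection $f:\Lambda\to\Lambda'$ and $C>0$ with $|f(x)-x|<C$ for all $x\in\Lambda$. *)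

(* Defs.v *)
From mathcomp Require Import all_boot all_order all_algebra.
From mathcomp Require Import all_classical all_reals all_analysis.

Set Implicit Arguments.
Unset Strict Implicit.
Unset Printing Implicit Defensive.

Import Order.TTheory GRing.Theory Num.Theory.
Import numFieldNormedType.Exports.

Local Open Scope classical_set_scope.
Local Open Scope ring_scope.

(* The alphabet N_0 with a point at infinity: the letter [m] is [Some m] and
   the letter [oo] is [None]. *)
Notation alphabet := (one_point_compactification nat).

(* [rho a c] is the substitution with parameters (a_i); [c] is the eventual
   value of the sequence [a] and governs the image of [oo]. *)
Definition rho (a : nat -> nat) (c : nat) (b : alphabet) : seq alphabet :=
  match b with
  | Some 0%N => nseq (a 0%N) (Some 0%N) ++ [:: Some 1%N]
  | Some i.+1 => nseq (a i.+1) (Some 0%N) ++ [:: Some i; Some i.+2]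
  | None => nseq c (Some 0%N) ++ [:: None; None]
  end.

Definition subst_word (sigma : alphabet -> seq alphabet) (w : seq alphabet) :
    seq alphabet :=
  flatten (map sigma w).

Definition subst_iter (sigma : alphabet -> seq alphabet) (n : nat)
    (b : alphabet) : seq alphabet :=
  iter n (subst_word sigma) [:: b].

Definition constant_length (sigma : alphabet -> seq alphabet) : Prop :=
  exists L : nat, forall b : alphabet, size (sigma b) = L.

(* Finite words as points of the disjoint union over n of the product spaces
   alphabet^n, so that [closure] below refers to that topology. *)
Definition word_space : topologicalType :=
  {n : nat & {ptws 'I_n -> alphabet}}.

Definition word_point (w : seq alphabet) : word_space :=
  existT (fun n => {ptws 'I_n -> alphabet}) (size w) (tnth (in_tuple w)).

Definition subwords (sigma : alphabet -> seq alphabet) : set word_space :=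
  [set p | exists (n : nat) (b : alphabet) (w : seq alphabet),
     [/\ (1 <= n)%N, infix w (subst_iter sigma n b) & p = word_point w]].

Definition factor (x : int -> alphabet) (j : int) (n : nat) : word_space :=
  existT (fun n => {ptws 'I_n -> alphabet}) n (fun i : 'I_n => x (j + i%:Z)).

Definition shift_space (sigma : alphabet -> seq alphabet) :
    set (int -> alphabet) :=
  [set x | forall (j : int) (n : nat), closure (subwords sigma) (factor x j n)].

Section Geometry.
Variable R : realType.

Definition is_mu (a : nat -> nat) (mu : R) : Prop :=
  [/\ 0 < mu, mu < 1 &
      series (fun i => (a i)%:R * mu ^+ i) @ \oo --> mu^-1].

(* In the exponent below 1 <= j <= m and j <= i, so that the subtraction on
   nat is never truncated. *)
Definition ell_nat (a : nat -> nat) (mu : R) (m : nat) : R :=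
  if m == 0%N then 1
  else mu ^+ m + \sum_(1 <= j < m.+1)
         limn (fun n => \sum_(j <= i < n) (a i)%:R * mu ^+ (i + m + 1 - 2 * j)%N).

Definition ell (a : nat -> nat) (mu : R) (b : alphabet) : R :=
  match b with
  | Some m => ell_nat a mu m
  | None => limn (ell_nat a mu)
  end.

(* [p j] is the left endpoint of the tile with label [x j]; the choice of
   [p 0] accounts for the translations. *)
Definition arises_from (sigma : alphabet -> seq alphabet) (l : alphabet -> R)
    (Lambda : set R) : Prop :=
  exists (x : int -> alphabet) (p : int -> R),
    [/\ shift_space sigma x,
        forall j : int, p (j + 1) = p j + l (x j) &
        Lambda = range p].

Definition bounded_distance_equivalent (Lambda Lambda' : set R) : Prop :=
  exists (f : R -> R) (C : R),
    [/\ set_bij Lambda Lambda' f, 0 < C &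
        forall x, Lambda x -> `|f x - x| < C].

Definition scaled_int (alpha : R) : set R := range (fun k : int => alpha * k%:~R).

End Geometry.

(* Main.v *)
Require Import Defs.
From mathcomp Require Import all_boot all_order all_algebra.
From mathcomp Require Import all_classical all_reals all_analysis.
From mathcomp Require Import ring lra zify.

Set Implicit Arguments.
Unset Strict Implicit.
Unset Printing Implicit Defensive.

Import Order.TTheory GRing.Theory Num.Theory.
Import numFieldNormedType.Exports.

Local Open Scope classical_set_scope.
Local Open Scope ring_scope.

(** Write rho for the substitution, N_n(j) for the number of letters of
rho^n([j]) and lam = mu + 1/mu.

A set at bounded distance from alpha Z has, between the endpoints of any L
consecutive tiles, length alpha L up to a bounded error
([bounded_discrepancy]). The word rho^n([j]) has only isolated letters and
occurs in every sufficiently long subword of every rho^m(b), so it occurs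
verbatim, and not only approximately, in every element of the shift space
([subst_iter_recurrent], [shift_space_occurs]). Its total length is lam^n
ell(j), hence |lam^n ell(j) - alpha N_n(j)| is bounded uniformly in n and j.
Everything else is a contradiction with this bound.

On functions f on the finite letters the substitution acts by (M f)(j) = a_j
f(0) + f(j-1) + f(j+1), and M N_n = N_(n+1), M ell = lam ell. The sequence a
is eventually constant, so in terms of the increments d_j = f(j) - f(j-1) the
operator becomes d_(j-1) + d_(j+1) plus a source e_j f(0) with only finitely
many nonzero e_j. For 1 < z < 2, sequences with s_(j+2) = z s_(j+1) - s_j are
bounded and form a plane, in which s can be chosen, depending polynomially on
z, with sum_j e_j s_(j+1) = s_0; pairing with such an s cancels the source
([pairing_step]). The pairing of s with the increments of N_n is then z^n s_1
([pairing_count]), while with those of ell it would have to be multiplied both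
by lam and by z, hence is zero up to a geometrically small truncation error
([pairing_length]). Truncating at an index proportional to n, the uniform
bound gives alpha z^n |s_1| = O(n), so s_1 = 0.

For that choice, made in [defect_eq0], s_1 is the value at z of the polynomial
1 + sum_j e_j U_(j-1) in the Chebyshev polynomials U, the [defect]. It
vanishes on an interval, hence identically, and linear independence of the U_j
gives e_1 = -1 and e_j = 0 for j > 1: that is a_0 = a_1 + 1 and a_1 = a_2 =
..., which says that rho has constant length ([defect_constant_length]). *)

(** * Growth of sequences *)

Section Growth.
Variable R : realType.
Implicit Types (z x : R).

Lemma bernoulli_le z n : 1 <= z -> 1 + n%:R * (z - 1) <= z ^+ n.
Proof.
move=> z1; elim: n => [|n IH]; first by rewrite mul0r addr0 expr0.
rewrite exprS; apply: le_trans (ler_wpM2l _ IH); last lra.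
rewrite -[n.+1]addn1 natrD.
have : 0 <= n%:R * (z - 1) * (z - 1) by rewrite !mulr_ge0 ?subr_ge0.
by nra.
Qed.

Lemma exp_large z x : 1 < z -> exists n, x <= z ^+ n.
Proof.
move=> z1; have zm : 0 < z - 1 by lra.
exists (Num.bound `|x / (z - 1)|).
apply: le_trans (bernoulli_le _ (ltW z1)).
have h := le_lt_trans (ler_norm _) (archi_boundP (normr_ge0 (x / (z - 1)))).
by move: h; rewrite ltr_pdivrMr // => h; lra.
Qed.

(** Bernoulli's inequality applied to the square of z^m already gives growth
quadratic in the exponent 2m. *)
Lemma exp_beats_linear z (d A B : R) : 1 < z -> 0 < d ->
  ~ (forall n, d * z ^+ n <= A + B * n%:R).
Proof.
move=> z1 d0 H; have zm : 0 < z - 1 by lra.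
pose D := (`|A| + 2 * `|B|) / (d * (z - 1) ^+ 2).
have D0 : 0 < d * (z - 1) ^+ 2 by rewrite mulr_gt0 // exprn_gt0.
pose m := (Num.bound D).+1.
have hm : D < m%:R.
  apply: lt_trans (_ : (Num.bound D)%:R < _); last by rewrite ltr_nat.
  apply: archi_boundP; apply: divr_ge0; last exact: ltW.
  by rewrite addr_ge0 ?normr_ge0 // mulr_ge0.
have m1 : 1 <= m%:R :> R by rewrite ler1n.
have := H (m + m)%N; rewrite exprD natrD => Hm.
have bz := bernoulli_le m (ltW z1).
move: hm; rewrite /D ltr_pdivrMr // => hm.
have hz : m%:R * (z - 1) <= z ^+ m by lra.
have hz2 : (m%:R * (z - 1)) * (m%:R * (z - 1)) <= z ^+ m * z ^+ m.
  by apply: ler_pM => //; rewrite mulr_ge0 // ltW.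
have hd : d * ((m%:R * (z - 1)) * (m%:R * (z - 1))) <= A + B * (m%:R + m%:R).
  by apply: le_trans Hm; rewrite ler_pM2l.
have hA : A <= `|A| * m%:R.
  by apply: le_trans (ler_norm A) _; rewrite ler_peMr.
have hB : B * m%:R <= `|B| * m%:R by rewrite ler_wpM2r // ler_norm.
have : (`|A| + 2 * `|B|) * m%:R < m%:R * (d * (z - 1) ^+ 2) * m%:R.
  by rewrite ltr_pM2r //; lra.
rewrite (_ : m%:R * (d * (z - 1) ^+ 2) * m%:R =
  d * ((m%:R * (z - 1)) * (m%:R * (z - 1)))); last by ring.
by move=> ?; lra.
Qed.

(** The quadratic form s_j^2 - z s_j s_(j+1) + s_(j+1)^2 is constant along the
recurrence, and it is positive definite exactly when |z| < 2. *)
Lemma chebyshev_rec_bounded z (s : nat -> R) : -2 < z -> z < 2 ->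
  (forall j, s j.+2 = z * s j.+1 - s j) ->
  exists B, forall j, `|s j| <= B.
Proof.
move=> z1 z2 rec.
pose Q := s 0%N ^+ 2 - z * s 0%N * s 1%N + s 1%N ^+ 2.
have QE j : s j ^+ 2 - z * s j * s j.+1 + s j.+1 ^+ 2 = Q.
  by elim: j => // j IH; rewrite -IH rec; ring.
have w0 : 0 < 1 - z ^+ 2 / 4 by nra.
exists (1 + Q / (1 - z ^+ 2 / 4)) => j.
have : s j ^+ 2 <= Q / (1 - z ^+ 2 / 4).
  rewrite ler_pdivlMr // -(QE j) -subr_ge0.
  rewrite (_ : _ - _ = (s j.+1 - z / 2 * s j) ^+ 2); last by field.
  exact: sqr_ge0.
by rewrite -(real_normK (num_real (s j))) => h; nra.
Qed.

End Growth.

(** * Chebyshev polynomials *)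

Section Chebyshev.
Variable R : realType.

(** These are the Chebyshev polynomials of the second kind in the variable
z = 2 cos t, shifted by one: [cheb n] takes the value sin (n t) / sin t at z. *)
Fixpoint cheb (n : nat) : {poly R} :=
  match n with
  | 0%N => 0
  | m.+1 => match m with 0%N => 1 | p.+1 => 'X * cheb m - cheb p end
  end.

Arguments cheb : simpl never.

Lemma chebSS n : cheb n.+2 = 'X * cheb n.+1 - cheb n.
Proof. by []. Qed.

Lemma size_cheb n : (size (cheb n) <= n)%N.
Proof.
suff: (size (cheb n) <= n)%N /\ (size (cheb n.+1) <= n.+1)%N by case.
elim: n => [|n [IH1 IH2]]; first by rewrite size_poly0 size_poly1.
split=> //; rewrite chebSS; apply: leq_trans (size_polyD _ _) _; rewrite size_polyN.
rewrite geq_max; apply/andP; split; last by rewrite !leqW.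
apply: leq_trans (size_polyMleq _ _) _; rewrite size_polyX; lia.
Qed.

Lemma lead_cheb n : (cheb n.+1)`_n = 1.
Proof.
elim: n => [|n IH]; first by rewrite coef1.
by rewrite chebSS coefB coefXM /= IH (nth_default 0 (leqW (size_cheb n))) subr0.
Qed.

Lemma cheb_free n (c : nat -> R) :
  \sum_(i < n) c i *: cheb i.+1 = 0 -> forall i, (i < n)%N -> c i = 0.
Proof.
elim: n => [//|n IH]; rewrite big_ord_recr /= => H.
have cn : c n = 0.
  have := congr1 (fun p : {poly R} => p`_n) H.
  rewrite /= coefD coefZ lead_cheb coef0 mulr1 coef_sum big1 ?add0r // => i _.
  by rewrite coefZ nth_default ?mulr0 // (leq_trans (size_cheb _)).
move=> i; rewrite ltnS leq_eqVlt => /orP[/eqP->//|].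
by apply: IH; rewrite cn scale0r addr0 in H.
Qed.

Lemma poly_zero_on_unit_interval (p : {poly R}) :
  (forall z, 1 < z -> z < 2 -> p.[z] = 0) -> p = 0.
Proof.
move=> H; apply/eqP/negPn/negP => p0.
pose f (i : nat) : R := 1 + i.+2%:R^-1.
have rts : all (root p) [seq f i | i <- iota 0 (size p)].
  apply/allP => _ /mapP[i _ ->]; rewrite /root H // /f.
    by rewrite ltrDl invr_gt0 ltr0n.
  by rewrite (_ : 2 = 1 + 1 :> R) // ltrD2l invf_lt1 ?ltr0n // ltr1n.
have unq : uniq [seq f i | i <- iota 0 (size p)].
  rewrite map_inj_uniq ?iota_uniq // => i j /addrI/invr_inj/eqP.
  by rewrite eqr_nat => /eqP[].
by have := max_poly_roots p0 rts unq; rewrite size_map size_iota ltnn.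
Qed.

End Chebyshev.

(** * The substitution acting on increments *)

Section Increments.
Variable R : realType.
Implicit Types (f g s : nat -> R) (a : nat -> nat).

(** The function is extended by 0 to the index -1, so that the increments
determine it. *)
Definition incr f (j : nat) : R := if j is i.+1 then f j - f i else f 0%N.

(** The value at j is the sum of f over the letters of the image of [j], so this
is the transpose of the infinite incidence matrix. *)
Definition subst_op a f (j : nat) : R :=
  (a j)%:R * f 0%N + (if j is i.+1 then f i else 0) + f j.+1.

(** The coefficient of f 0 when the increments of [subst_op a f] are expressed
by those of f; at j = 0 the summand 1 appears because f 1 is f 0 plus an
increment. *)
Definition source a (j : nat) : R :=
  incr (fun i => (a i)%:R) j + (j == 0%N)%:R.

(** Summation by parts: the free part of the operator is symmetric, so it can be
moved to s, where it acts as multiplication by z. The last two summands are the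
boundary terms of the truncation. *)
Lemma pairing_subst_op a f s (z : R) (J : nat) :
  (forall j, s j.+2 = z * s j.+1 - s j) ->
  \sum_(j < J.+1) s j.+1 * incr (subst_op a f) j =
  z * (\sum_(j < J.+1) s j.+1 * incr f j)
  + (\sum_(j < J.+1) source a j * s j.+1 - s 0%N) * f 0%N
  + s J.+1 * incr f J.+1 - s J.+2 * incr f J.
Proof.
move=> rec; elim: J => [|J IH].
  by rewrite !big_ord1 /= /source /subst_op /= rec; ring.
rewrite big_ord_recr /= IH [in RHS]big_ord_recr /=.
rewrite [\sum_(j < J.+2) source a j * _]big_ord_recr /=.
rewrite (rec J.+1); case: J {IH} => [|J]; rewrite /source /subst_op /=.
  by rewrite (rec 0%N); ring.
by rewrite (rec J.+1); ring.
Qed.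

End Increments.

(** * The obstruction polynomial *)

Section Obstruction.
Variable R : realType.
Variables (a : nat -> nat) (k : nat).
Hypothesis a_const : forall i, (k <= i)%N -> a i.+1 = a i.

(** The value at z of the entry s 1 of a solution s that cancels the source;
up to a factor t - 1/t it is the failure of the Laurent polynomial
(1 - t) (1 - t sum_i a_i t^i) / t to be invariant under t -> 1/t, where
z = t + 1/t. *)
Definition defect : {poly R} := 1 + \sum_(j < k.+1) source R a j *: cheb R j.

Lemma source_eq0 j : (k < j)%N -> source R a j = 0.
Proof. by case: j => // j kj; rewrite /source /= a_const // subrr add0r. Qed.

Lemma sum_source (s : nat -> R) J : (k <= J)%N ->
  \sum_(j < J.+1) source R a j * s j = \sum_(j < k.+1) source R a j * s j.
Proof.
move=> kJ; rewrite -(big_mkord xpredT (fun j => source R a j * s j)).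
rewrite -(big_mkord xpredT (fun j => source R a j * s j)).
rewrite (big_cat_nat (n := k.+1)) //= [X in _ + X]big1_seq ?addr0 // => j.
by rewrite mem_index_iota => /andP[_ /andP[kj _]]; rewrite source_eq0 ?mul0r.
Qed.

Section Pairing.
Variables (s : nat -> R) (z : R).
Hypothesis s_rec : forall j, s j.+2 = z * s j.+1 - s j.
Hypothesis s_source : \sum_(j < k.+1) source R a j * s j.+1 = s 0%N.

Lemma pairing_step f J : (k <= J)%N ->
  \sum_(j < J.+1) s j.+1 * incr (subst_op a f) j =
  z * (\sum_(j < J.+1) s j.+1 * incr f j)
  + s J.+1 * incr f J.+1 - s J.+2 * incr f J.
Proof.
move=> kJ; rewrite (pairing_subst_op _ _ _ s_rec).
by rewrite (sum_source (fun j => s j.+1) kJ) s_source subrr mul0r addr0.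
Qed.

Variable N : nat -> nat -> R.
Hypothesis N0 : forall j, N 0%N j = 1.
Hypothesis NS : forall n j, N n.+1 j = subst_op a (N n) j.

(** The image length is the same for all letters with large index, and one more
iteration shifts the threshold by one. *)
Lemma incr_count_eq0 n j : (n + k <= j)%N -> incr (N n) j.+1 = 0.
Proof.
elim: n j => [|n IH] [|j] //= nkj.
- by rewrite !N0 subrr.
- by rewrite !N0 subrr.
rewrite !NS /subst_op a_const; last by lia.
have nkj' : (n + k <= j)%N by lia.
have h1 := IH j nkj'; have h3 := IH j.+2 (leqW (leqW nkj')).
by rewrite /= in h1 h3; lra.
Qed.

Lemma pairing_count n J : (n + k <= J)%N ->
  \sum_(j < J.+1) s j.+1 * incr (N n) j = z ^+ n * s 1%N.
Proof.
elim: n J => [|n IH] J nkJ.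
  rewrite big_ord_recl big1 /= ?N0; first by rewrite expr0; ring.
  by move=> i _; rewrite !N0 subrr mulr0.
case: J nkJ => // J nkJ.
have -> : N n.+1 = subst_op a (N n) by apply/funext => j; exact: NS.
rewrite pairing_step ?IH //; try lia.
rewrite !incr_count_eq0; try lia.
by rewrite exprS; ring.
Qed.

Variables (mu lam A : R) (len : nat -> R).
Hypotheses (mu_gt0 : 0 < mu) (mu_lt1 : mu < 1).
Hypotheses (z_gt1 : 1 < z) (z_lt2 : z < 2) (lam_ge2 : 2 <= lam).
Hypothesis lenS : forall j, lam * len j = subst_op a len j.
Hypothesis incr_len : forall j, (k <= j)%N -> `|incr len j.+1| <= A * mu ^+ j.

(** Since [len] is an eigenfunction for lam and the pairing intertwines with
multiplication by z, the factor lam - z times the truncated pairing consists of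
boundary terms only, and these decay like the increments of [len]. *)
Lemma pairing_length B J : (forall j, `|s j| <= B) -> (k <= J)%N ->
  `|\sum_(j < J.+2) s j.+1 * incr len j| <= 2 * B * A / (lam - z) * mu ^+ J.
Proof.
move=> sB kJ; set T := \sum_(j < J.+2) _.
have lz : 0 < lam - z by rewrite subr_gt0 (lt_le_trans z_lt2).
have incrZ j : incr (fun i => lam * len i) j = lam * incr len j.
  by case: j => //= j; ring.
have TE : T * (lam - z) = s J.+2 * incr len J.+2 - s J.+3 * incr len J.+1.
  have := pairing_step len (leqW kJ).
  have -> : subst_op a len = (fun i => lam * len i).
    by apply/funext => j; rewrite lenS.
  under eq_bigr do rewrite incrZ mulrCA.
  rewrite -mulr_sumr -/T; set U := s _ * _; set V := s _ * _ => E.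
  have -> : T * (lam - z) = lam * T - z * T by ring.
  by rewrite E; ring.
have B0 : 0 <= B by apply: le_trans (sB 0%N).
have A0 : 0 <= A * mu ^+ J by apply: le_trans (incr_len kJ).
have b1 : `|s J.+2 * incr len J.+2| <= B * (A * mu ^+ J).
  rewrite normrM; apply: ler_pM => //.
  apply: le_trans (incr_len (leqW kJ)) _; rewrite exprS.
  by rewrite mulrCA ler_piMl // ltW.
have b2 : `|s J.+3 * incr len J.+1| <= B * (A * mu ^+ J).
  by rewrite normrM; apply: ler_pM => //; exact: incr_len.
rewrite -(ler_pM2r lz) -{1}(gtr0_norm lz) -normrM TE.
apply: le_trans (ler_normB _ _) _.
rewrite [leRHS](_ : _ = B * (A * mu ^+ J) + B * (A * mu ^+ J)).
  exact: lerD.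
by field; apply: lt0r_neq0.
Qed.

Variables (alpha C : R).
Hypothesis alpha_gt0 : 0 < alpha.
Hypothesis close : forall n j, `|lam ^+ n * len j - alpha * N n j| <= C.

(** The pairing of s with the increments of lam^n len - alpha N_n, truncated at an
index proportional to n, is O(n) by the uniform bound, but it equals
- alpha z^n s_1 up to a bounded error. *)
Lemma pairing_initial_eq0 : s 1%N = 0.
Proof.
have z_gtN2 : -2 < z by apply: lt_trans z_gt1; lra.
have [B sB] := chebyshev_rec_bounded z_gtN2 z_lt2 s_rec.
have B0 : 0 <= B by apply: le_trans (sB 0%N).
have C0 : 0 <= C by apply: le_trans (close 0 0).
have lam0 : 0 < lam by apply: lt_le_trans lam_ge2; rewrite ltr0n.
have muV : 1 < mu^-1 by rewrite invf_gt1.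
have [K hK] := exp_large lam muV.
(* The truncation index grows fast enough for mu^J to compensate lam^n. *)
have lam_mu : lam * mu ^+ K.+1 <= 1.
  rewrite exprVn -[leRHS]div1r ler_pdivlMr ?exprn_gt0 // in hK.
  apply: le_trans hK; rewrite ler_pM2l // exprS.
  by rewrite ler_piMl ?exprn_ge0 // ltW.
apply/eqP/negPn/negP => s1.
pose D := 2 * B * A / (lam - z).
apply: (@exp_beats_linear _ z (alpha * `|s 1%N|)
  (`|D| + k.+2%:R * (2 * B * C)) (K.+1%:R * (2 * B * C)) z_gt1).
  by rewrite mulr_gt0 ?normr_gt0.
move=> n; pose J := (K.+1 * n + k)%N.
have kJ : (k <= J)%N by rewrite leq_addl.
have nkJ : (n + k <= J.+1)%N by rewrite /J leqW // leq_add2r leq_pmull.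
have := pairing_length sB kJ; set T := \sum_(j < J.+2) _ => hT.
have := pairing_count nkJ; set M := \sum_(j < J.+2) _ => hM.
have close_incr j : `|lam ^+ n * incr len j - alpha * incr (N n) j| <= 2 * C.
  case: j => [|j] /=.
    by apply: le_trans (close n 0%N) _; rewrite mulr_natl mulr2n lerDl.
  rewrite (_ : _ - _ = (lam ^+ n * len j.+1 - alpha * N n j.+1) -
    (lam ^+ n * len j - alpha * N n j)); last by ring.
  apply: le_trans (ler_normB _ _) _.
  by rewrite (_ : 2 * C = C + C); [exact: lerD|ring].
have hS : `|lam ^+ n * T - alpha * M| <= J.+2%:R * (2 * B * C).
  rewrite /T /M !mulr_sumr -sumrB; apply: le_trans (ler_norm_sum _ _ _) _.
  apply: le_trans (_ : \sum_(j < J.+2) 2 * B * C <= _).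
    apply: ler_sum => j _; rewrite (_ : _ - _ =
      s j.+1 * (lam ^+ n * incr len j - alpha * incr (N n) j)); last by ring.
    rewrite normrM (_ : 2 * B * C = B * (2 * C)); last by ring.
    exact: ler_pM.
  by rewrite sumr_const card_ord -[leLHS]mulr_natl.
have hL : `|lam ^+ n * T| <= `|D|.
  have lamn0 : 0 < lam ^+ n by rewrite exprn_gt0.
  rewrite normrM (gtr0_norm lamn0).
  apply: le_trans (_ : lam ^+ n * (`|D| * mu ^+ J) <= _).
    rewrite ler_pM2l //; apply: le_trans hT _.
    by rewrite ler_wpM2r ?ler_norm // exprn_ge0 // ltW.
  rewrite mulrCA ler_piMr // /J exprD exprM mulrA -exprMn.
  have mu0 := ltW mu_gt0.
  have p0 : 0 <= lam * mu ^+ K.+1 by rewrite mulr_ge0 ?exprn_ge0 // ltW.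
  by apply: mulr_ile1; rewrite ?exprn_ge0 ?exprn_ile1 // ltW.
have -> : alpha * `|s 1%N| * z ^+ n = `|alpha * M|.
  rewrite hM !normrM (gtr0_norm alpha_gt0) (ger0_norm (exprn_ge0 _ _)).
    by ring.
  exact: le_trans ler01 (ltW z_gt1).
have -> : alpha * M = lam ^+ n * T - (lam ^+ n * T - alpha * M) by ring.
apply: le_trans (ler_normB _ _) _.
apply: le_trans (lerD hL hS) _.
rewrite /J -addn2 -addnA !natrD natrM; rewrite -[k.+2]addn2 natrD.
by rewrite le_eqVlt; apply/orP; left; apply/eqP; ring.
Qed.

End Pairing.

Lemma defect_horner z :
  defect.[z] = 1 + \sum_(j < k.+1) source R a j * (cheb R j).[z].
Proof.
rewrite hornerD hornerC horner_sum; congr (_ + _).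
by apply: eq_bigr => j _; rewrite hornerZ.
Qed.

Section Bounded.
Variables (N : nat -> nat -> R) (mu lam A alpha C : R) (len : nat -> R).
Hypothesis N0 : forall j, N 0%N j = 1.
Hypothesis NS : forall n j, N n.+1 j = subst_op a (N n) j.
Hypotheses (mu_gt0 : 0 < mu) (mu_lt1 : mu < 1) (lam_ge2 : 2 <= lam).
Hypothesis lenS : forall j, lam * len j = subst_op a len j.
Hypothesis incr_len : forall j, (k <= j)%N -> `|incr len j.+1| <= A * mu ^+ j.
Hypothesis alpha_gt0 : 0 < alpha.
Hypothesis close : forall n j, `|lam ^+ n * len j - alpha * N n j| <= C.

(** For each z in (1, 2) the solution s below is the combination of the two basic
solutions of the recurrence that lies in the kernel of the source functional;
its entry s_1 is the value of the defect at z. *)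
Lemma defect_eq0 : defect = 0.
Proof.
apply: poly_zero_on_unit_interval => z z1 z2.
pose r j := (cheb R j).[z].
have rS j : r j.+2 = z * r j.+1 - r j.
  by rewrite /r chebSS hornerD hornerN hornerM hornerX.
pose X := \sum_(j < k.+1) source R a j * r j.+1.
pose Y := 1 + \sum_(j < k.+1) source R a j * r j.
pose s j := if j is i.+1 then Y * r i.+1 - X * r i else X.
(* The second basic solution is r shifted by one index and negated: it starts
   with 1, 0. *)
have r0 : r 0%N = 0 by rewrite /r horner0.
have r1 : r 1%N = 1 by rewrite /r hornerC.
have sS j : s j.+2 = z * s j.+1 - s j.
  by case: j => [|j]; rewrite /s !rS ?r0 ?r1; ring.
have s_source : \sum_(j < k.+1) source R a j * s j.+1 = s 0%N.
  rewrite /= (eq_bigr (fun j : 'I_k.+1 => Y * (source R a j * r j.+1) -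
    X * (source R a j * r j))); last by move=> j _; ring.
  by rewrite sumrB -!mulr_sumr -/X /Y; ring.
have := pairing_initial_eq0 sS s_source N0 NS mu_gt0 mu_lt1 z1 z2 lam_ge2 lenS
  incr_len alpha_gt0 close.
by rewrite /= r0 r1 mulr0 subr0 mulr1 defect_horner.
Qed.

End Bounded.
End Obstruction.

Section ConstantLength.
Variables (R : realType) (a : nat -> nat) (k c : nat).
Hypothesis a_c : forall i, (k <= i)%N -> a i = c.

(** Moving the summand 1, which is the first Chebyshev polynomial, into the sum
turns the vanishing of the defect into a linear relation between Chebyshev
polynomials. The bound k + 1 makes room for that summand even when k = 0. *)
Lemma defect_constant_length : defect R a k.+1 = 0 -> constant_length (rho a c).
Proof.
rewrite /defect big_ord_recl scaler0 add0r => D0.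
have free : \sum_(i < k.+1) (source R a i.+1 + (i == 0%N :> nat)%:R) *: cheb R i.+1 = 0.
  rewrite (eq_bigr (fun i : 'I_k.+1 => source R a i.+1 *: cheb R i.+1 +
    (i == 0%N :> nat)%:R *: cheb R i.+1)); last by move=> i _; rewrite scalerDl.
  rewrite big_split -[RHS]D0 /= addrC; congr (_ + _).
  rewrite big_ord_recl big1 /= ?addr0 ?scale1r // => i _.
  by rewrite scale0r.
have {}free := cheb_free (c := fun i => source R a i.+1 + (i == 0%N)%:R) free.
have a01 : a 0%N = (a 1%N).+1.
  have := free 0%N isT; rewrite /source /= addr0 => /eqP.
  rewrite addrAC subr_eq0 -natrD addn1 eqr_nat => /eqP <- //.
have aS i : a i.+2 = a i.+1.
  have [ki|ik] := leqP k.+1 i.+1; first by rewrite !a_c //; lia.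
  have := free i.+1 ik; rewrite /source /= !addr0 => /eqP.
  by rewrite subr_eq0 eqr_nat => /eqP.
have a1 i : a i.+1 = a 1%N by elim: i => // i <-.
have ac : a 1%N = c by rewrite -(a_c (leqnSn k)) a1.
exists c.+2 => -[[|i]|] /=; rewrite size_cat size_nseq /= ?a01 ?a1 ?ac ?addn1 ?addn2 //.
Qed.

End ConstantLength.

(** * Tile lengths *)

Section TileLengths.
Variables (R : realType) (a : nat -> nat) (mu : R).
Hypothesis mu_root : is_mu a mu.

Let mu_gt0 : 0 < mu. Proof. by case: mu_root. Qed.
Let mu_lt1 : mu < 1. Proof. by case: mu_root. Qed.
Let mu_neq0 : mu != 0. Proof. exact: lt0r_neq0. Qed.

Let psum (n : nat) : R := series (fun i => (a i)%:R * mu ^+ i) n.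
Let psum_cvg : psum @ \oo --> mu^-1. Proof. by case: mu_root. Qed.
Let psumS n : psum n.+1 = psum n + (a n)%:R * mu ^+ n.
Proof. by rewrite /psum /series /= big_nat_recr. Qed.

Let mu_expr_cvg : (GRing.exp mu : R ^nat) @ \oo --> (0 : R).
Proof. by apply: cvg_expr; rewrite ger0_norm // ltW. Qed.

(** This is the sum of the series a_(j+i) mu^i over i, since 1/mu is the sum of
the whole series; the closed form makes its recursion purely algebraic. *)
Definition tail (j : nat) : R := (mu^-1 - psum j) / mu ^+ j.

Lemma tail_rec j : tail j = (a j)%:R + mu * tail j.+1.
Proof.
rewrite /tail psumS exprS invfM; field.
by rewrite mu_neq0 expf_neq0.
Qed.

Lemma tail0 : tail 0 = mu^-1.
Proof. by rewrite /tail /psum /series /= big_geq // subr0 expr0 divr1. Qed.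

Lemma tail_ge0 j : 0 <= tail j.
Proof.
rewrite divr_ge0 ?exprn_ge0 ?subr_ge0 //; last exact: ltW.
rewrite -(cvg_lim _ psum_cvg) //; apply: nondecreasing_cvgn_le; last first.
  by apply/cvg_ex; exists mu^-1.
apply/nondecreasing_seqP => n; rewrite psumS lerDl.
by rewrite mulr_ge0 ?exprn_ge0 // ltW.
Qed.

Lemma tail_cvg j :
  (fun n => \sum_(j <= i < n) (a i)%:R * mu ^+ i) @ \oo --> mu ^+ j * tail j.
Proof.
rewrite /tail mulrC divfK ?expf_neq0 //.
have: psum - cst (psum j) @ \oo --> mu^-1 - psum j by apply: cvgB => //; exact: cvg_cst.
apply: cvg_trans; apply: near_eq_cvg; exists j => // n /= jn.
rewrite /psum /series !fctE /= (big_cat_nat (n := j)) //=.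
by rewrite addrC addKr.
Qed.

Lemma ell_natE m :
  ell_nat a mu m = mu ^+ m + \sum_(1 <= j < m.+1) mu ^+ (m.+1 - j) * tail j.
Proof.
rewrite /ell_nat; case: eqP => [->|_]; first by rewrite big_geq // addr0.
congr (_ + _); apply: eq_big_nat => j /andP[j1 jm].
apply/cvg_lim => //.
have -> : (fun n => \sum_(j <= i < n) (a i)%:R * mu ^+ (i + m + 1 - 2 * j)) =
    (fun n => mu ^+ (m.+1 - j) / mu ^+ j * \sum_(j <= i < n) (a i)%:R * mu ^+ i).
  apply/funext => n; rewrite mulr_sumr; apply: eq_big_nat => i /andP[ji _].
  have -> : (i + m + 1 - 2 * j = (m.+1 - j) + (i - j))%N by lia.
  have -> : mu ^+ i = mu ^+ j * mu ^+ (i - j) by rewrite -exprD subnKC.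
  rewrite exprD; move: (m.+1 - j)%N (i - j)%N => p q.
  by field; rewrite expf_neq0.
have := cvgM (cvg_cst (mu ^+ (m.+1 - j) / mu ^+ j)) (@tail_cvg j).
by rewrite mulrA divfK ?expf_neq0 //; apply.
Qed.

Lemma ell_nat0 : ell_nat a mu 0 = 1. Proof. by []. Qed.

(** The double series defining the lengths is governed by this first-order
recursion, from which the eigenvalue equation, positivity and the geometric
convergence all follow. *)
Lemma ell_natS m : ell_nat a mu m.+1 = mu * ell_nat a mu m + mu * tail m.+1.
Proof.
rewrite !ell_natE big_nat_recr //= subSnn expr1 exprS mulrDr -!addrA.
congr (_ + (_ + _)); rewrite mulr_sumr; apply: eq_big_nat => j /andP[_ jm].
by rewrite subSn 1?ltnW // exprS mulrA.
Qed.

Lemma ell_nat_eigen j :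
  (mu + mu^-1) * ell_nat a mu j = subst_op a (ell_nat a mu) j.
Proof.
rewrite /subst_op ell_natS; case: j => [|j].
  rewrite ell_nat0; have := tail_rec 0; rewrite tail0 => E.
  rewrite {1}E; ring.
rewrite ell_natS mulr1 (tail_rec j.+1); field.
exact: mu_neq0.
Qed.

Lemma ell_nat_gt0 m : 0 < ell_nat a mu m.
Proof.
elim: m => [|m IH]; first by rewrite ell_nat0.
by rewrite ell_natS ltr_pwDl ?mulr_gt0 // mulr_ge0 ?tail_ge0 // ltW.
Qed.

Lemma inflation_ge2 : 2 <= mu + mu^-1.
Proof.
rewrite -subr_ge0 (_ : _ - _ = (mu - 1) ^+ 2 / mu); last by field.
by rewrite divr_ge0 ?sqr_ge0 // ltW.
Qed.

Variables (k c : nat).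
Hypothesis a_c : forall i, (k <= i)%N -> a i = c.

Lemma tail_const j : (k <= j)%N -> tail j = c%:R / (1 - mu).
Proof.
move=> kj; have m1 : 1 - mu != 0 by rewrite subr_eq0 gt_eqF.
have SE n : psum (n + j) =
    psum j + c%:R / (1 - mu) * mu ^+ j - c%:R / (1 - mu) * mu ^+ j * mu ^+ n.
  elim: n => [|n IH]; first by rewrite expr0 mulr1 addrK.
  rewrite addSn psumS IH a_c ?exprD ?exprS; last by lia.
  by field.
have : (fun n => psum (n + j)) @ \oo --> psum j + c%:R / (1 - mu) * mu ^+ j.
  under eq_fun do rewrite SE.
  move: (c%:R / _ * _) => K; move: (psum j + K) => L.
  have := cvgB (cvg_cst L) (cvgM (cvg_cst K) mu_expr_cvg).
  by rewrite mulr0 subr0; apply.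
rewrite (cvg_shiftn j psum) => h; rewrite /tail (cvg_unique _ psum_cvg h) //.
by field; rewrite m1 expf_neq0.
Qed.

(** The fixed point of the recursion of the lengths once the tails are constant,
hence the length of the tile of the letter at infinity. *)
Let ell_lim : R := c%:R * mu / (1 - mu) ^+ 2.

Lemma ell_nat_geometric :
  exists A, forall m, (k <= m)%N -> ell_nat a mu m = ell_lim + A * mu ^+ m.
Proof.
exists ((ell_nat a mu k - ell_lim) / mu ^+ k) => m km.
rewrite -(subnK km); elim: (m - k)%N => [|n IH].
  by rewrite add0n divfK ?expf_neq0 // addrC subrK.
rewrite addSn ell_natS IH tail_const; last by lia.
move: ((ell_nat a mu k - ell_lim) / mu ^+ k) => A.
rewrite /ell_lim [mu ^+ _.+1]exprS; field.
by rewrite subr_eq0 gt_eqF.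
Qed.

Lemma incr_ell_nat_le :
  exists A, forall j, (k <= j)%N -> `|incr (ell_nat a mu) j.+1| <= A * mu ^+ j.
Proof.
have [A AE] := ell_nat_geometric; exists `|A| => j kj.
rewrite /= !AE //; last exact: leqW.
rewrite (_ : _ - _ = (A * mu ^+ j) * (mu - 1)); last by rewrite exprS; ring.
have mj : 0 <= mu ^+ j by rewrite exprn_ge0 // ltW.
rewrite !normrM (ger0_norm mj) ler_piMr ?mulr_ge0 //.
by rewrite distrC gtr0_norm ?subr_gt0 // gerBl ltW.
Qed.

Hypothesis c_gt0 : (0 < c)%N.

Let ell_lim_gt0 : 0 < ell_lim.
Proof. by rewrite divr_gt0 ?exprn_gt0 ?mulr_gt0 ?ltr0n // subr_gt0. Qed.

(** Positivity for the letter at infinity uses that its length is a genuine limit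
with an explicit positive value. *)
Lemma ell_gt0 b : 0 < ell a mu b.
Proof.
case: b => [m|] /=; first exact: ell_nat_gt0.
have [A AE] := ell_nat_geometric.
suff -> : limn (ell_nat a mu) = ell_lim by [].
apply/cvg_lim => //; rewrite -(cvg_shiftn k).
under eq_fun do rewrite AE ?leq_addl // addnC exprD mulrA.
have := cvgD (cvg_cst ell_lim) (cvgM (cvg_cst (A * mu ^+ k)) mu_expr_cvg).
by rewrite mulr0 addr0; apply.
Qed.

End TileLengths.

(** * Words and their images *)

Section Words.
Variable sigma : alphabet -> seq alphabet.
Implicit Types (w W : seq alphabet) (ss : seq (seq alphabet)) (b : alphabet).

Lemma subst_iterE n w :
  iter n (subst_word sigma) w = flatten (map (subst_iter sigma n) w).
Proof.
have iter_nil m : iter m (subst_word sigma) [::] = [::] by elim: m => //= m ->.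
have iter_cat m u v : iter m (subst_word sigma) (u ++ v) =
    iter m (subst_word sigma) u ++ iter m (subst_word sigma) v.
  by elim: m => //= m ->; rewrite /subst_word map_cat flatten_cat.
elim: w => [|b w IH] /=; first exact: iter_nil.
by rewrite -cat1s iter_cat IH.
Qed.

Lemma subst_iterD n m b :
  subst_iter sigma (n + m) b = flatten (map (subst_iter sigma n) (subst_iter sigma m b)).
Proof. by rewrite /subst_iter iterD subst_iterE. Qed.

Lemma subst_iterS n b :
  subst_iter sigma n.+1 b = flatten (map (subst_iter sigma n) (sigma b)).
Proof. by rewrite -addn1 subst_iterD /subst_iter /subst_word /= cats0. Qed.

Lemma infix_subst_iter n m b b0 : b \in subst_iter sigma m b0 ->
  infix (subst_iter sigma n b) (subst_iter sigma (n + m) b0).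
Proof.
rewrite subst_iterD; elim: (subst_iter sigma m b0) => //= b' w IH.
rewrite inE => /predU1P[->|/IH]; first exact: prefix_infix.
exact: infix_catl.
Qed.

Lemma size_subst_iter L n b : (forall b', (size (sigma b') <= L)%N) ->
  (size (subst_iter sigma n b) <= L ^ n)%N.
Proof.
move=> sL; elim: n b => [//|n IH] b.
rewrite subst_iterS size_flatten /shape -map_comp sumnE big_map.
apply: (@leq_trans (\sum_(b' <- sigma b) L ^ n)).
  by apply: leq_sum => b' _; exact: IH.
by rewrite big_const_seq count_predT iter_addn_0 expnS mulnC leq_mul2r sL orbT.
Qed.

Lemma prefix_block W L w ss : {in ss, forall s, infix W s /\ (size s <= L)%N} ->
  prefix w (flatten ss) -> (0 < size w)%N -> (L <= size w)%N -> infix W w.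
Proof.
case: ss => [|s ss] /= hs; first by case: w.
have [/infixP[u [v sE]] sL] := hs s (mem_head _ _).
move=> /prefixP[r E] _ Lw.
have sw : (size s <= size w)%N by apply: leq_trans sL Lw.
have := congr1 (take (size w)) E; rewrite take_size_cat // => <-.
rewrite take_cat ltnNge sw /= sE -!catA; apply: infix_catl; exact: prefix_infix.
Qed.

(** A window longer than two blocks either starts beyond the first block, or
contains the whole block after the one in which it starts. *)
Lemma infix_block W L w ss : {in ss, forall s, infix W s /\ (size s <= L)%N} ->
  infix w (flatten ss) -> (L + L < size w)%N -> infix W w.
Proof.
elim: ss => [|s ss IH] hs /infixP[u [v /= E]] Lw.
  have /eqP := congr1 size E; rewrite !size_cat /=; lia.
have [us|su] := ltnP (size u) (size s); last first.
  apply: IH => //; first by move=> s' hs'; apply: hs; rewrite inE hs' orbT.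
  apply/infixP; exists (drop (size s) u), v.
  have := congr1 (drop (size s)) E; rewrite drop_size_cat // => ->.
  by rewrite -{1}(cat_take_drop (size s) u) -catA drop_size_cat // size_takel.
have [_ sL] := hs s (mem_head _ _).
set d := (size s - size u)%N; have dL : (d <= L)%N by apply: leq_trans (leq_subr _ _) sL.
have E2 : flatten ss = drop d w ++ v.
  have := congr1 (drop (size s)) E; rewrite drop_size_cat // => ->.
  by rewrite drop_cat ltnNge ltnW //= drop_cat ifT //; rewrite -/d; lia.
have : infix W (drop d w).
  apply: (@prefix_block _ L _ ss); rewrite ?size_drop; try lia.
    by move=> s' hs'; apply: hs; rewrite inE hs' orbT.
  by rewrite E2 prefix_prefix.
by move=> /(infix_catl (take d w)); rewrite cat_take_drop.
Qed.

End Words.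

Section Rho.
Variables (a : nat -> nat) (k c : nat).
Local Notation sigma := (rho a c).

Lemma sum_rho (V : pzRingType) (F : alphabet -> V) j :
  \sum_(x <- sigma (Some j)) F x =
  (a j)%:R * F (Some 0%N) + (if j is i.+1 then F (Some i) else 0) + F (Some j.+1).
Proof.
rewrite mulr_natl.
by case: j => [|j]; rewrite /= big_cat big_nseq iter_addr_0 /= !big_cons big_nil
  !addr0 ?addrA.
Qed.

Lemma mem_subst_iterS (s : alphabet -> seq alphabet) m b0 b b' :
  b \in subst_iter s m b0 -> b' \in s b -> b' \in subst_iter s m.+1 b0.
Proof. by move=> hb hb'; apply/flattenP; exists (s b) => //; exact: map_f. Qed.

Lemma letter_mem_subst_iter i : (Some i : alphabet) \in subst_iter sigma i (Some 0%N).
Proof.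
elim: i => [|i IH]; first by rewrite inE.
apply: mem_subst_iterS IH _.
by case: i => [|i]; rewrite /= mem_cat !inE eqxx !orbT.
Qed.

(** Finite letters never produce the letter at infinity, so these words consist
of isolated points of the alphabet. *)
Lemma isSome_subst_iter n i : all isSome (subst_iter sigma n (Some i)).
Proof.
elim: n i => [//|n IH] i; rewrite subst_iterS.
apply/allP => y /flattenP[_ /mapP[[j|] + ->]]; first by move=> _; exact/allP.
by case: i => [|i] /=; rewrite mem_cat mem_nseq !inE andbF.
Qed.

Hypothesis a0_gt0 : (0 < a 0)%N.
Hypothesis c_gt0 : (0 < c)%N.
Hypothesis a_c : forall i, (k <= i)%N -> a i = c.

(** A letter [i] with i <= k walks down to [0] in i steps, even if the a_j on the
way vanish; all other letters produce [0] at once; and [0] reproduces itself. *)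
Lemma zero_mem_subst_iter b : (Some 0%N : alphabet) \in subst_iter sigma k.+1 b.
Proof.
have z0 : (Some 0%N : alphabet) \in sigma (Some 0%N).
  by rewrite /= mem_cat mem_nseq a0_gt0 eqxx.
have up m n : (m <= n)%N -> (Some 0%N : alphabet) \in subst_iter sigma m b ->
    (Some 0%N : alphabet) \in subst_iter sigma n b.
  by move=> /subnK <- h; elim: (n - m)%N => // d IH; apply: mem_subst_iterS IH z0.
have self : b \in subst_iter sigma 0 b by rewrite inE.
case: b up self => [i|] up self; last first.
  apply: (up 1%N) => //; apply: mem_subst_iterS self _.
  by rewrite /= mem_cat mem_nseq c_gt0 eqxx.
have [ik|ki] := ltnP i k.+1.
  apply: (up i) => //; first exact: ltnW.
  suff : forall m, (m <= i)%N ->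
      (Some (i - m)%N : alphabet) \in subst_iter sigma m (Some i).
    by move=> /(_ i (leqnn _)); rewrite subnn.
  elim=> [_|m IH mi]; first by rewrite subn0.
  apply: mem_subst_iterS (IH (ltnW mi)) _.
  have -> : (i - m = (i - m.+1).+1)%N by lia.
  by rewrite /= mem_cat !inE eqxx orbT.
apply: (up 1%N) => //; apply: mem_subst_iterS self _.
case: i ki {up} => [//|i] ki; rewrite /= mem_cat mem_nseq a_c ?c_gt0 ?eqxx //.
by apply: ltnW.
Qed.

Lemma size_rho_bounded : exists L, forall b, (size (sigma b) <= L)%N.
Proof.
exists (\sum_(i < k) a i + c + 2)%N.
have aL i : (a i <= \sum_(i < k) a i + c)%N.
  have [ik|ki] := ltnP i k; last by rewrite a_c // leq_addl.
  by rewrite (bigD1 (Ordinal ik)) //= -addnA leq_addr.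
case=> [[|i]|] /=; rewrite size_cat size_nseq /=.
- by rewrite addn1 addn2 ltnS leqW.
- by rewrite leq_add2r.
- by rewrite leq_add2r leq_addl.
Qed.

(** For m >= q = n + i + k + 1 the word rho^m(b) is a concatenation of blocks
rho^q(b') of bounded length; each block contains rho^(n+i)([0]), because
rho^(k+1)(b') contains [0], and thus rho^n([i]), because rho^i([0]) contains
[i]. *)
Lemma subst_iter_recurrent n i : exists N, forall m b w,
  infix w (subst_iter sigma m b) -> size w = N ->
  infix (subst_iter sigma n (Some i)) w.
Proof.
have [L sL] := size_rho_bounded; pose q := (n + i + k.+1)%N.
have L1 : (0 < L)%N by apply: leq_trans (sL None); rewrite /= size_cat addn_gt0 orbT.
have block b : infix (subst_iter sigma n (Some i)) (subst_iter sigma q b) /\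
    (size (subst_iter sigma q b) <= L ^ q)%N.
  split; last exact: size_subst_iter.
  apply: infix_trans (infix_subst_iter _ (zero_mem_subst_iter b)).
  exact: infix_subst_iter (letter_mem_subst_iter i).
(* This length also exceeds that of every rho^m(b) with m < q. *)
exists (L ^ q + L ^ q).+1 => m b w hw szw.
have [qm|mq] := leqP q m.
  apply: (@infix_block _ (L ^ q) _
    (map (subst_iter sigma q) (subst_iter sigma (m - q) b))).
  - by move=> _ /mapP[b' _ ->]; exact: block.
  - by rewrite -subst_iterD subnKC.
  - by rewrite szw.
have := leq_trans (size_infix hw) (size_subst_iter m b sL).
have : (L ^ m <= L ^ q)%N by rewrite leq_pexp2l // ltnW.
by rewrite szw; lia.
Qed.

End Rho.

(** * Occurrence of words in the shift space *)

Section ShiftSpace.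

Lemma nbhs_letter K (b : alphabet) :
  nbhs b [set y : alphabet | forall m, (m < K)%N -> (y == Some m) = (b == Some m)].
Proof.
case: b => [n|].
  have n1 := @one_point_compactification_some_nbhs nat n _ (discrete_set1 n).
  apply: (filterS _ n1).
  by move=> _ [_ -> <-].
exists [set m | (m < K)%N].
  split; last exact: discrete_closed.
  by apply: finite_compact; exact: finite_II.
move=> y [[m /= mK <-]|->] // m' m'K.
apply/negP => /eqP[E]; apply: mK; by rewrite E.
Qed.

Variable sigma : alphabet -> seq alphabet.

(** A neighbourhood of a long factor of x that decides, at each position, which
of finitely many isolated letters stands there contains a subword of some
iterate; an occurrence of W in that subword is an occurrence in x. *)
Lemma shift_space_occurs (x : int -> alphabet) (W : seq alphabet) N :
  shift_space sigma x ->
  all isSome W ->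
  (forall m b w, infix w (subst_iter sigma m b) -> size w = N -> infix W w) ->
  exists j : int, forall t, (t < size W)%N -> x (j + t%:Z) = nth None W t.
Proof.
move=> Xx WS HN.
have [K WK] : exists K, forall m, (Some m : alphabet) \in W -> (m < K)%N.
  elim: W {WS HN} => [|b W [K WK]]; first by exists 0%N.
  exists (maxn K (odflt 0%N b).+1) => m; rewrite inE leq_max => /predU1P[<-|/WK ->//].
  by rewrite /= leqnn orbT.
pose V (i : 'I_N) : set {ptws 'I_N -> alphabet} := [set y |
  forall m, (m < K)%N -> (y i == Some m) = (x (0 + i%:Z) == Some m)].
pose x' : {ptws 'I_N -> alphabet} := fun i => x (0 + i%:Z).
have nV i : nbhs x' (V i).
  exact: (@proj_continuous _ (fun=> alphabet) i x' _ (nbhs_letter K (x' i))).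
have nU : nbhs x' [set y | forall i, V i y].
  exact: (@filter_forall _ _ V (nbhs x') _ nV).
have [_ [[m [b [w [_ hw ->]]]] [y Uy yw]]] := Xx 0 N _ (@existT_nbhs _ _ N x' _ nU).
pose get (q : word_space) (t : nat) : alphabet :=
  if insub t is Some i then projT2 q i else None.
have szw : size w = N by have := congr1 (@projT1 _ _) yw.
have get_y t (tN : (t < N)%N) : y (Ordinal tN) = nth None w t.
  have := congr1 (get^~ t) yw; rewrite /get /= !insubT ?szw // => tw /=.
  by rewrite (tnth_nth None).
have /infixP[u [v wE]] := HN m b w hw szw.
exists (size u)%:Z => t tW.
have tN : (size u + t < N)%N by rewrite -szw wE !size_cat ltn_add2l ltn_addr.
have ytW : y (Ordinal tN) = nth None W t.
  by rewrite get_y wE nth_cat ltnNge leq_addr /= addKn nth_cat tW.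
have /all_nthP-/(_ None t tW) := WS.
case E : (nth None W t) => [m'|//] _.
have m'K : (m' < K)%N by apply: WK; rewrite -E mem_nth.
by have := Uy (Ordinal tN) _ m'K; rewrite ytW E eqxx add0r => /esym/eqP.
Qed.

End ShiftSpace.

(** * Bounded distance equivalence to a lattice *)

Section BoundedDistance.
Variable R : realType.

Lemma card_int_interval n (h : nat -> int) (lo hi : int) :
  (0 < n)%N -> (forall i, (i < n)%N -> lo <= h i <= hi) ->
  (forall i j, (i < n)%N -> (j < n)%N -> h i = h j -> i = j) ->
  n%:Z <= hi - lo + 1.
Proof.
move=> n0 hb hinj.
have lohi : lo <= hi by have /andP[] := hb _ n0; exact: le_trans.
have dE : hi - lo = `|hi - lo|%N%:Z by rewrite gez0_abs // subr_ge0.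
have : (size [seq h i | i <- iota 0 n] <=
        size [seq (lo + i%:Z)%R | i <- iota 0 `|hi - lo|%N.+1])%N.
  apply: uniq_leq_size.
    by rewrite map_inj_in_uniq ?iota_uniq // => i j; rewrite !mem_iota => hi' hj';
      apply: hinj.
  move=> y /mapP[i]; rewrite mem_iota => /hb /andP[l u] ->.
  apply/mapP; exists `|h i - lo|%N; last by rewrite gez0_abs ?subr_ge0 // subrKC.
  by rewrite mem_iota; lia.
by rewrite !size_map !size_iota; lia.
Qed.

Variables (p : int -> R) (alpha C : R) (f : R -> R).
Hypothesis alpha_gt0 : 0 < alpha.
Hypothesis C_gt0 : 0 < C.
Hypothesis p_step : forall j, p j < p (j + 1).
Hypothesis f_bij : set_bij (range p) (scaled_int alpha) f.
Hypothesis f_close : forall x, range p x -> `|f x - x| < C.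

Let p_addn j n : p j <= p (j + n%:Z).
Proof.
elim: n => [|n IH]; first by rewrite addr0.
by rewrite -addn1 PoszD addrA (le_trans IH) // ltW.
Qed.

Let p_mono i j : i <= j -> p i <= p j.
Proof.
move=> ij; have -> : j = i + `|j - i|%N%:Z by rewrite gez0_abs ?subr_ge0 // subrKC.
exact: p_addn.
Qed.

Let p_lt i j : (p i < p j) = (i < j).
Proof.
apply/idP/idP => [|ij]; first by apply: contraTT; rewrite -!leNgt; exact: p_mono.
by apply: lt_le_trans (p_step i) _; apply: p_mono; rewrite lezD1.
Qed.

Let p_inj i j : p i = p j -> i = j.
Proof.
move=> E; apply/eqP; rewrite eq_le !leNgt -!p_lt E ltxx //.
Qed.

Let phi_ex j : exists i : int, f (p j) = alpha * i%:~R.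
Proof.
have [fun_f _ _] := f_bij; have [i _ <-] := fun_f (p j) (ex_intro2 _ _ j I erefl).
by exists i.
Qed.

(** Two pigeonhole arguments through the induced bijection of the integers: the
L + 1 endpoints p_j, ..., p_(j+L) go to distinct lattice points in the interval
[p_j - C, p_(j+L) + C], and the lattice points in [p_j + C, p_(j+L) - C] come,
if L > 0, from the L - 1 endpoints strictly between p_j and p_(j+L). *)
Lemma bounded_discrepancy (j : int) (L : nat) :
  `|p (j + L%:Z) - p j - alpha * L%:R| <= C + C.
Proof.
have [phi phiE] := choice phi_ex.
have close i : `|alpha * (phi i)%:~R - p i| < C.
  by rewrite -phiE; apply: f_close; exists i.
have phi_inj i i' : phi i = phi i' -> i = i'.
  move=> E; apply: p_inj; have [_ inj_f _] := f_bij.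
  by apply: inj_f; rewrite ?inE; [exists i|exists i'|rewrite !phiE E].
have phi_sur m : exists i, phi i = m.
  have [_ _ sur_f] := f_bij.
  have [_ [i _ <-] E] := sur_f (alpha * m%:~R) (ex_intro2 _ _ m I erefl).
  exists i; apply/eqP; rewrite -(eqr_int R); apply/eqP.
  by apply: (mulfI (lt0r_neq0 alpha_gt0)); rewrite -phiE.
have [psi psiK] := choice phi_sur.
have psi_inj m m' : psi m = psi m' -> m = m' by move=> E; rewrite -(psiK m) E psiK.
have [->|L0] := posnP L; first by rewrite addr0 subrr mulr0 subr0 normr0 addr_ge0 // ltW.
set P := p (j + L%:Z).
rewrite ler_distl; apply/andP; split.
- pose u := Num.ceil ((p j - C) / alpha); pose v := Num.floor ((P + C) / alpha).
  have H : L.+1%:Z <= v - u + 1.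
    apply: (card_int_interval (h := fun i => phi (j + i%:Z))) => // [i iL|i i' _ _].
      have := close (j + i%:Z); rewrite ltr_distl => /andP[l r].
      have h1 := p_addn j i.
      have h2 : p (j + i%:Z) <= P by apply: p_mono; rewrite lerD2l lez_nat -ltnS.
      rewrite /u /v ceil_le_int floor_ge_int ler_pdivrMr // ler_pdivlMr //.
      by apply/andP; split; rewrite mulrC; lra.
    by move=> /phi_inj /addrI [].
  have u1 := ceil_ge ((p j - C) / alpha); rewrite -/u in u1.
  have v1 := floor_le ((P + C) / alpha); rewrite -/v in v1.
  have : (L%:Z)%:~R <= (v - u)%:~R :> R by rewrite ler_int; lia.
  rewrite intrB => H2.
  have : L%:R <= (P + C) / alpha - (p j - C) / alpha by apply: le_trans H2 _; lra.
  by rewrite -mulrBl ler_pdivlMr // => ?; rewrite mulrC; lra.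
- pose u := Num.ceil ((p j + C) / alpha); pose v := Num.floor ((P - C) / alpha).
  have H : v - u + 1 <= L%:Z - 1.
    have [|vu] := leP (v - u + 1) 0; first by lia.
    have nE : v - u + 1 = `|(v - u + 1)%R|%N%:Z by rewrite gtz0_abs.
    have -> : L%:Z - 1 = (j + L%:Z - 1) - (j + 1) + 1 by ring.
    rewrite nE; apply: (card_int_interval (h := fun i => psi (u + i%:Z))).
    - by rewrite absz_gt0 gt_eqF.
    - move=> i iv; have : u <= u + i%:Z <= v by lia.
      move: (u + i%:Z) => w; rewrite /u /v ceil_le_int floor_ge_int.
      rewrite ler_pdivrMr // ler_pdivlMr // mulrC => /andP[l' r'].
      have := close (psi w); rewrite psiK ltr_distl => /andP[l r].
      have : p j < p (psi w) by lra.
      have : p (psi w) < P by lra.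
      by rewrite /P !p_lt; lia.
    - by move=> i i' _ _ /psi_inj /addrI [].
  have u1 := ceilB1_lt ((p j + C) / alpha); rewrite -/u in u1.
  have v1 := floorD1_gt ((P - C) / alpha); rewrite -/v in v1.
  have : (v + 1 - (u - 1))%:~R <= (L%:Z)%:~R :> R by rewrite ler_int; lia.
  rewrite intrB => H2.
  have : (P - C) / alpha - (p j + C) / alpha <= L%:R by apply: le_trans H2; lra.
  by rewrite -mulrBl ler_pdivrMr // => ?; rewrite mulrC; lra.
Qed.

End BoundedDistance.

(** * Counting letters and measuring words *)

Section Counting.
Variables (R : realType) (a : nat -> nat) (c : nat) (mu : R).

Lemma sum_subst_iterS (F : alphabet -> R) n j :
  \sum_(x <- subst_iter (rho a c) n.+1 (Some j)) F x =
  subst_op a (fun i => \sum_(x <- subst_iter (rho a c) n (Some i)) F x) j.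
Proof. by rewrite subst_iterS big_flatten big_map sum_rho. Qed.

Lemma size_subst_iterS n j :
  (size (subst_iter (rho a c) n.+1 (Some j)))%:R =
  subst_op a (fun i => (size (subst_iter (rho a c) n (Some i)))%:R) j :> R.
Proof.
have sizeE (w : seq alphabet) : (size w)%:R = \sum_(x <- w) 1 :> R.
  by rewrite big_const_seq count_predT iter_addr_0.
by rewrite sizeE sum_subst_iterS /subst_op -!sizeE; case: j => [|j] //; rewrite -sizeE.
Qed.

Lemma sum_ell_subst_iter n j : is_mu a mu ->
  \sum_(x <- subst_iter (rho a c) n (Some j)) ell a mu x =
  (mu + mu^-1) ^+ n * ell_nat a mu j.
Proof.
move=> mu_root; elim: n j => [|n IH] j; first by rewrite big_seq1 expr0 mul1r.
rewrite sum_subst_iterS exprSr -mulrA ell_nat_eigen //.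
by rewrite /subst_op !IH; case: j => [|j]; rewrite ?IH; ring.
Qed.

End Counting.

Lemma endpoint_difference (R : realType) (l : alphabet -> R) (x : int -> alphabet)
    (p : int -> R) (j : int) (n : nat) :
  (forall j : int, p (j + 1) = p j + l (x j)) ->
  p (j + n%:Z) - p j = \sum_(t < n) l (x (j + t%:Z)).
Proof.
move=> pS; elim: n => [|n IH]; first by rewrite big_ord0 addr0 subrr.
by rewrite big_ord_recr /= -IH -addn1 PoszD addrA pS addrAC.
Qed.

(** * From bounded discrepancy to constant length *)

Unset Implicit Arguments.

Theorem corollary4p12 (R : realType) (a : nat -> nat) (k c : nat) (mu : R)
    (ha0 : (0 < a 0)%N) (hc : (0 < c)%N)
    (hac : forall i : nat, (k <= i)%N -> a i = c)
    (hmu : is_mu a mu)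
    (hnc : ~ constant_length (rho a c)) :
  forall Lambda : set R, arises_from (rho a c) (ell a mu) Lambda ->
  forall alpha : R, 0 < alpha ->
    ~ bounded_distance_equivalent Lambda (scaled_int alpha).
Proof.
move=> _ [x [p [Xx pS ->]]] alpha alpha_gt0 [f [C [f_bij C_gt0 f_close]]].
have [mu_gt0 mu_lt1 _] := hmu.
have p_step j : p j < p (j + 1) by rewrite pS ltrDl (ell_gt0 hmu hac hc).
have [A incr_le] := incr_ell_nat_le hmu hac.
apply: hnc; apply: (defect_constant_length (R := R) hac).
have a_const i : (k.+1 <= i)%N -> a i.+1 = a i by move=> ki; rewrite !hac // ltnW // ltnW.
apply: (defect_eq0 a_const (mu := mu) (lam := mu + mu^-1) (A := A)
  (alpha := alpha) (C := C + C) (len := ell_nat a mu)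
  (N := fun n j => (size (subst_iter (rho a c) n (Some j)))%:R)) => //.
- by move=> n j; exact: size_subst_iterS.
- exact: inflation_ge2 hmu.
- by move=> j; exact: ell_nat_eigen.
- by move=> j kj; apply: incr_le; exact: ltnW.
move=> n j; rewrite -(sum_ell_subst_iter c n j hmu).
have [N recN] := subst_iter_recurrent ha0 hc hac n j.
have [i xE] := shift_space_occurs Xx (isSome_subst_iter a c n j) recN.
have := bounded_discrepancy alpha_gt0 C_gt0 p_step f_bij f_close i
  (size (subst_iter (rho a c) n (Some j))).
rewrite (endpoint_difference _ _ pS) (big_nth None) big_mkord.
by under eq_bigr => t _ do rewrite xE //.
Qed.
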